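(* Let $C$ be an $m$-continued fraction of length $\omega$ with associated $\underline p_k,q_k,d_k$, and let $\underline r=\varphi(C)$. Put $d_\omega=\infty$ if $\omega<\infty$. Let $q(z)\in F[z]$ be such that $d_k\le\deg(q(z))<d_{k+1}$ for some $0\le k<\omega$. Then $$Iv\left(\underline r-\frac{\lfloor\underline r q(z)\rfloor}{q(z)}\right)\le Iv\left(\underline r-\frac{\underline p_k(z)}{q_k(z)}\right).$$ As a consequence, for each $0\le k<\omega$ the fraction $\underline p_k(z)/q_k(z)$ is a best rational approximant to $\underline r$, and the degree of any best denominator of $\underline r$ equals $d_k$ for some $0\le k<\omega$.
   Context: Let $F$ be a field, $m\ge 1$ an integer, $Z_m=\{1,\dots,m\}$. $F((z^{-1}))$ is the field of formal Laurent series $\sum_{t\ge i}a_tz^{-t}$ ($i\in\mathbb Z$, $a_t\in F$), with valuation $v(\sum_{t\ge i}a_tz^{-t})=i$ if $a_i\ne 0$, and $v(0)=\infty$. Elements of $F((z^{-1}))^m$ are column vectors. For $\alpha\in F((z^{-1}))$, $\lfloor\alpha\rfloor\in F[z]$ is the polynomial part (terms $z^{i}$, $i\ge0$) and $\{\alpha\}=\alpha-\lfloor\alpha\rfloor$; both are extended componentwise to vectors. Order $Z_m\times\mathbb Z$ linearly by $(h,v)<(h',v')$ iff $v<v'$, or $v=v'$ and $h<h'$. For $\underline r=(r_1,\dots,r_m)^\tau\ne\underline 0$ put $v(\underline r)=\min_i v(r_i)$, $I(\underline r)=\min\{i: v(r_i)=v(\underline r)\}$ and $Iv(\underline r)=(I(\underline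 r),v(\underline r))$; $Iv(\underline 0)=(1,\infty)$, which is larger than every element of $Z_m\times\mathbb Z$. Best approximation: any nonzero polynomial $q$ is called a denominator of $\underline r$, with precision $Iv(\underline r-\lfloor\underline r q\rfloor/q)$. A fraction $\underline p/q$ with $\underline p\in F[z]^m$, $0\ne q\in F[z]$ is a best rational approximant of $\underline r$ if every denominator of degree $<\deg q$ has precision strictly lower than $Iv(\underline r-\underline p/q)$ and every denominator of degree equal to $\deg q$ has precision no greater than $Iv(\underline r-\underline p/q)$; in this case $q$ is called a best denominator of $\underline r$. An $m$-pre-continued fraction of length $\omega$ ($\omega$ a positive integer or $\infty$) is $C=[\underline a_0,h_1,\underline a_1,h_2,\underline a_2,\dots]$ with $\underline a_0=\underline 0$, $h_k\in Z_m$ and $\underline a_k=(a_{k,1},\dots,a_{k,m})^\tau\in F[z]^m$ for $1\le k<\omega$. Let $E_h$ be the matrix obtained from $I_{m+1}$ by exchanging columns $h$ and $m+1$, and $A(\underline a)=\begin{pmatrix} I_m&\underline a\\0&1\end{pmatrix}$. Put $B_0=I_{m+1}$, $B_k=B_{k-1}E_{h_k}A(\underline a_k)$ for $1\le k<\omega$; the last column of $B_k$ is written $\begin{pmatrix}\underline p_k\\ q_k\end{pmatrix}$ with $\underline p_k\in F[z]^m$, $q_k\in F[z]$. Condition 1: $\deg a_{k,h_k}\ge 1$ for $1\le k<\omega$. Under Condition 1 put $t_k=\deg a_{k,h_k}$, $v_{k,j}=\sum_{1\le i\le k,\,h_i=j}t_i$ (so $v_{0,j}=0$), $v_k=v_{k,h_k}$,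 $d_k=\sum_{1\le i\le k}t_i$ ($d_0=0$), $D_k=\mathrm{Diag}(z^{-v_{k,1}},\dots,z^{-v_{k,m}})$. Condition 2: $(h_k,v_{k-1,h_k})<(h_{k+1},v_{k+1})$ for $1\le k<\omega-1$. Condition 3: $Iv(D_k\underline a_k)=(h_k,v_{k-1,h_k})$ for $1\le k<\omega$. (Convention $\infty-1=\infty$.) An $m$-continued fraction is an $m$-pre-continued fraction satisfying Conditions 1, 2, 3. For an $m$-continued fraction $C$ all $q_k$ are nonzero, and $\varphi(C)=\underline p_{\omega-1}/q_{\omega-1}$ if $\omega<\infty$, $\varphi(C)=\lim_{k\to\infty}\underline p_k/q_k$ (which exists) if $\omega=\infty$. *)

(* Defs.v *)
From HB Require Import structures.
From mathcomp Require Import all_boot all_order all_algebra.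
From mathcomp Require Import boolp classical_sets functions cardinality fsbigop.
From mathcomp Require Import constructive_ereal.
From mathcomp Require Import zify ring.

Set Implicit Arguments.
Unset Strict Implicit.
Unset Printing Implicit Defensive.

Import Order.TTheory GRing.Theory Num.Theory.
Local Open Scope classical_set_scope.
Local Open Scope ring_scope.

(* An element of F((z^-1)) is its coefficient family: [lcoef a t] is the      *)
(* coefficient of z^(-t), and vanishes for t small enough.                    *)
Record laurent (F : fieldType) := Laurent {
  lcoef :> int -> F;
  lcoef_bounded : exists N : int, forall t : int, t < N -> lcoef t = 0
}.

HB.instance Definition _ (F : fieldType) := gen_eqMixin (laurent F).
HB.instance Definition _ (F : fieldType) := gen_choiceMixin (laurent F).

Lemma laurentP (F : fieldType) (a b : laurent F) : (forall t, a t = b t) -> a = b.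
Proof.
case: a b => [a Ha] [b Hb] /= /funext ab; rewrite -{}ab in Hb *.
by congr Laurent; exact: Prop_irrelevance.
Qed.

Lemma lzero_subproof (F : fieldType) :
  exists N : int, forall t : int, t < N -> (fun=> 0 : F) t = 0.
Proof. by exists 0. Qed.
Definition lzero (F : fieldType) : laurent F := Laurent (lzero_subproof F).

Lemma lopp_subproof (F : fieldType) (a : laurent F) :
  exists N : int, forall t : int, t < N -> - a t = 0.
Proof. by have [N aN] := lcoef_bounded a; exists N => t /aN->; rewrite oppr0. Qed.
Definition lopp (F : fieldType) (a : laurent F) := Laurent (lopp_subproof a).

Lemma bound2 (F : fieldType) (a b : laurent F) :
  exists N : int, forall t : int, t < N -> a t = 0 /\ b t = 0.
Proof.
have [N aN] := lcoef_bounded a; have [M bM] := lcoef_bounded b.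
exists (Order.min N M) => t; rewrite lt_min => /andP[tN tM].
by split; [apply: aN | apply: bM].
Qed.

Lemma ladd_subproof (F : fieldType) (a b : laurent F) :
  exists N : int, forall t : int, t < N -> a t + b t = 0.
Proof.
have [N abN] := bound2 a b.
by exists N => t /abN[-> ->]; rewrite addr0.
Qed.
Definition ladd (F : fieldType) (a b : laurent F) := Laurent (ladd_subproof a b).

Fact laddA (F : fieldType) : associative (@ladd F).
Proof. by move=> a b c; apply: laurentP => t /=; rewrite addrA. Qed.
Fact laddC (F : fieldType) : commutative (@ladd F).
Proof. by move=> a b; apply: laurentP => t /=; rewrite addrC. Qed.
Fact ladd0l (F : fieldType) : left_id (lzero F) (@ladd F).
Proof. by move=> a; apply: laurentP => t /=; rewrite add0r. Qed.
Fact laddNl (F : fieldType) : left_inverse (lzero F) (@lopp F) (@ladd F).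
Proof. by move=> a; apply: laurentP => t /=; rewrite addNr. Qed.

HB.instance Definition _ (F : fieldType) :=
  GRing.isZmodule.Build (laurent F) (@laddA F) (@laddC F) (@ladd0l F) (@laddNl F).

Lemma lcoef0 (F : fieldType) t : (0 : laurent F) t = 0. Proof. by []. Qed.
Lemma lcoefD (F : fieldType) (a b : laurent F) t : (a + b) t = a t + b t.
Proof. by []. Qed.
Lemma lcoefN (F : fieldType) (a : laurent F) t : (- a) t = - a t.
Proof. by []. Qed.

Lemma le_int_nat (N t : int) : N <= t -> exists k : nat, t = N + k%:Z.
Proof. by move=> Nt; exists `|t - N|%N; lia. Qed.

(* The sum over all of int has finite support whenever both arguments vanish  *)
(* for small indices.                                                         *)
Definition lconv (F : fieldType) (a b : int -> F) (t : int) : F :=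
  \sum_(i \in [set: int]) a i * b (t - i).

Lemma lconv_lt (F : fieldType) (a b : int -> F) (N M t : int) :
  (forall t : int, t < N -> a t = 0) -> (forall t : int, t < M -> b t = 0) ->
  t < N + M -> lconv a b t = 0.
Proof.
move=> aN bM tNM; apply: fsbig1 => i _.
case: (ltP i N) => [/aN->|Ni]; first by rewrite mul0r.
by rewrite bM ?mulr0//; lia.
Qed.

Lemma lconvE (F : fieldType) (a b : int -> F) (N M : int) (k : nat) :
  (forall t : int, t < N -> a t = 0) -> (forall t : int, t < M -> b t = 0) ->
  lconv a b (N + M + k%:Z) =
  \sum_(j < k.+1) a (N + j%:Z) * b (M + (k - j)%N%:Z).
Proof.
move=> aN bM; rewrite /lconv.
set r := [seq N + j%:Z | j <- iota 0 k.+1].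
rewrite -(fsbig_widen [set` r] setT)//=.
  rewrite -fsbig_seq; last by rewrite map_inj_uniq ?iota_uniq// => i j; lia.
  rewrite big_map -[iota 0 k.+1]/(index_iota 0 k.+1) big_mkord.
  by apply: eq_bigr => j _; congr (_ * b _); have := ltn_ord j; lia.
move=> i [_ /= ir].
case: (ltP i N) => [/aN->|Ni]; first by rewrite mul0r.
case: (ltP (N + M + k%:Z - i) M) => [/bM->|iM]; first by rewrite mulr0.
case: ir; apply/mapP; exists `|i - N|%N; last by lia.
by rewrite mem_iota; lia.
Qed.

Lemma lmul_subproof (F : fieldType) (a b : laurent F) :
  exists N : int, forall t : int, t < N -> lconv a b t = 0.
Proof.
have [N aN] := lcoef_bounded a; have [M bM] := lcoef_bounded b.
by exists (N + M) => t; apply: lconv_lt.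
Qed.
Definition lmul (F : fieldType) (a b : laurent F) := Laurent (lmul_subproof a b).

Definition ltrunc (F : fieldType) (a : laurent F) (N : int) (n : nat) : {poly F} :=
  \poly_(i < n) a (N + i%:Z).

Lemma lmulE (F : fieldType) (a b : laurent F) (N M : int) (k n : nat) :
  (forall t : int, t < N -> a t = 0) -> (forall t : int, t < M -> b t = 0) ->
  (k < n)%N ->
  lmul a b (N + M + k%:Z) = (ltrunc a N n * ltrunc b M n)`_k.
Proof.
move=> aN bM kn; rewrite /= (lconvE _ aN bM) coefM; apply: eq_bigr => j _.
by rewrite !coef_poly !ifT//; have := ltn_ord j; lia.
Qed.

Lemma lmul_lt (F : fieldType) (a b : laurent F) (N M t : int) :
  (forall t : int, t < N -> a t = 0) -> (forall t : int, t < M -> b t = 0) ->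
  t < N + M -> lmul a b t = 0.
Proof. exact: lconv_lt. Qed.

Lemma eq_coefMl (F : fieldType) (p q s : {poly F}) k :
  (forall i, (i <= k)%N -> p`_i = q`_i) -> (p * s)`_k = (q * s)`_k.
Proof.
by move=> pq; rewrite !coefM; apply: eq_bigr => j _; rewrite pq// -ltnS.
Qed.

Fact lmulC (F : fieldType) : commutative (@lmul F).
Proof.
move=> a b; apply: laurentP => t.
have [N aN] := lcoef_bounded a; have [M bM] := lcoef_bounded b.
case: (ltP t (N + M)) => [tNM|].
  by rewrite (lmul_lt aN bM tNM) (lmul_lt bM aN)// addrC.
move=> /le_int_nat[k ->].
rewrite (lmulE aN bM (ltnSn _)) mulrC -(lmulE bM aN (ltnSn _)).
by rewrite [(M + N)%R]addrC.
Qed.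

Fact lmulA (F : fieldType) : associative (@lmul F).
Proof.
move=> a b c; apply: laurentP => t.
have [N aN] := lcoef_bounded a; have [M bM] := lcoef_bounded b.
have [P cP] := lcoef_bounded c.
have abNM u : u < N + M -> lmul a b u = 0 by apply: lmul_lt.
have bcMP u : u < M + P -> lmul b c u = 0 by apply: lmul_lt.
case: (ltP t (N + M + P)) => [tNMP|].
  by rewrite (lmul_lt abNM cP tNMP) (lmul_lt aN bcMP)// addrA.
move=> /le_int_nat[k ->].
rewrite (lmulE abNM cP (ltnSn _)).
have := lmulE aN bcMP (ltnSn k); rewrite addrA => ->.
have E1 i : (i <= k)%N ->
    (ltrunc (lmul a b) (N + M) k.+1)`_i = (ltrunc a N k.+1 * ltrunc b M k.+1)`_i.
  by move=> ik; rewrite coef_poly ltnS ik (lmulE aN bM (_ : i < k.+1)%N).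
have E2 i : (i <= k)%N ->
    (ltrunc (lmul b c) (M + P) k.+1)`_i = (ltrunc b M k.+1 * ltrunc c P k.+1)`_i.
  by move=> ik; rewrite coef_poly ltnS ik (lmulE bM cP (_ : i < k.+1)%N).
rewrite (eq_coefMl _ E1) -mulrA [LHS]coefMr [RHS]coefMr.
by apply: eq_bigr => j _; rewrite E2// -ltnS.
Qed.

Fact lmulDl (F : fieldType) : left_distributive (@lmul F) +%R.
Proof.
move=> a b c; apply: laurentP => t; rewrite lcoefD.
have [N abN] := bound2 a b; have [P cP] := lcoef_bounded c.
have aN u : u < N -> a u = 0 by move=> /abN[].
have bN u : u < N -> b u = 0 by move=> /abN[].
have sN u : u < N -> (a + b) u = 0 by move=> /abN[aE bE]; rewrite lcoefD aE bE addr0.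
case: (ltP t (N + P)) => [tNP|/le_int_nat[k ->]].
  by rewrite (lmul_lt aN cP tNP) (lmul_lt bN cP tNP) (lmul_lt sN cP tNP) addr0.
rewrite /= !lconvE// -big_split; apply: eq_bigr => j _ /=.
by rewrite mulrDl.
Qed.

Lemma lpoly_subproof (F : fieldType) (p : {poly F}) :
  exists N : int, forall t : int, t < N -> (if t <= 0 then p`_`|t|%N else 0) = 0.
Proof.
exists (- (size p)%:Z) => t tp; case: ifP => // _.
by rewrite nth_default//; move: (size _) tp => n; lia.
Qed.
(* The inclusion of F[z] in F((z^-1)).                                        *)
Definition lpoly (F : fieldType) (p : {poly F}) : laurent F :=
  Laurent (lpoly_subproof p).

Lemma lcoef_poly (F : fieldType) (p : {poly F}) (t : int) :
  lpoly p t = if t <= 0 then p`_`|t|%N else 0.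
Proof. by []. Qed.
Lemma lcoef_poly_gt0 (F : fieldType) (p : {poly F}) (t : int) :
  0 < t -> lpoly p t = 0.
Proof. by move=> t0; rewrite lcoef_poly ifF//; lia. Qed.

Fact lmul1l (F : fieldType) : left_id (lpoly 1) (@lmul F).
Proof.
move=> a; apply: laurentP => t; have [N aN] := lcoef_bounded a.
have u0 u : u < 0 -> lpoly (1 : {poly F}) u = 0.
  by move=> ul0; rewrite /= ltW// coef1 (_ : (`|u|%N == 0%N) = false)//; lia.
case: (ltP t N) => [tN|Nt]; first by rewrite (lmul_lt u0 aN) ?add0r// aN.
have tE : t = 0 + N + `|t - N|%N%:Z by lia.
rewrite {1}tE -[LHS]/(lconv (lpoly 1) a _) (lconvE _ u0 aN) big_ord_recl.
rewrite big1 ?addr0.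
  by rewrite lcoef_poly coef1 eqxx mul1r; congr (a _); rewrite /=; lia.
by move=> i _; rewrite lcoef_poly_gt0 ?mul0r// /bump; lia.
Qed.

Fact lone_neq0 (F : fieldType) : lpoly 1 != 0 :> laurent F.
Proof.
apply/eqP => /(congr1 (fun a : laurent F => a 0)) /=.
by rewrite coef1 eqxx; apply/eqP; exact: oner_neq0.
Qed.

HB.instance Definition _ (F : fieldType) :=
  GRing.Zmodule_isComNzRing.Build (laurent F)
    (@lmulA F) (@lmulC F) (@lmul1l F) (@lmulDl F) (@lone_neq0 F).

Lemma lcoefM (F : fieldType) (a b : laurent F) t :
  (a * b) t = \sum_(i \in [set: int]) a i * b (t - i).
Proof. by []. Qed.

Lemma lpolyD (F : fieldType) (p q : {poly F}) : lpoly (p + q) = lpoly p + lpoly q.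
Proof.
by apply: laurentP => t; rewrite lcoefD /=; case: ifP; rewrite ?coefD ?addr0.
Qed.
Lemma lpoly0 (F : fieldType) : lpoly (0 : {poly F}) = 0.
Proof. by apply: laurentP => t /=; rewrite coef0 if_same. Qed.

Lemma lpolyM (F : fieldType) (p q : {poly F}) : lpoly (p * q) = lpoly p * lpoly q.
Proof.
apply: laurentP => t.
rewrite lcoefM; case: (leP t 0) => [t0|t0]; last first.
  rewrite /= ifF ?fsbig1//; last by lia.
  move=> i _; case: (leP i 0) => i0; last by rewrite mul0r.
  by rewrite [X in _ * X]ifF ?mulr0//; lia.
rewrite /= t0 coefM.
set r := [seq - j%:Z | j <- iota 0 `|t|.+1].
rewrite -(fsbig_widen [set` r] setT)//=.
  rewrite -fsbig_seq; last by rewrite map_inj_uniq ?iota_uniq// => i j; lia.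
  rewrite big_map -[iota 0 _.+1]/(index_iota 0 `|t|.+1) big_mkord.
  apply: eq_bigr => j _; have jt := ltn_ord j.
  by rewrite !ifT; [congr (p`__ * q`__)| |]; lia.
move=> i [_ /= ir].
case: (leP i 0) => i0; last by rewrite mul0r.
case: (leP (t - i) 0) => ti; last by rewrite mulr0.
by case: ir; apply/mapP; exists `|i|%N; rewrite ?mem_iota; lia.
Qed.

HB.instance Definition _ (F : fieldType) :=
  GRing.isNmodMorphism.Build {poly F} (laurent F) (@lpoly F) (lpoly0 F, @lpolyD F).
HB.instance Definition _ (F : fieldType) :=
  GRing.isMonoidMorphism.Build {poly F} (laurent F) (@lpoly F)
    (erefl, @lpolyM F).

Lemma lpoly_inj (F : fieldType) : injective (@lpoly F).
Proof.
move=> p q pq; apply/polyP => i.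
have := congr1 (fun a : laurent F => a (- i%:Z)) pq.
have i0 : - i%:Z <= 0 :> int by lia.
by rewrite !lcoef_poly i0 abszN.
Qed.

Definition is_order (F : fieldType) (a : laurent F) (i : int) : Prop :=
  a i != 0 /\ forall t : int, t < i -> a t = 0.

Lemma order_exists (F : fieldType) (a : laurent F) : a != 0 -> exists i, is_order a i.
Proof.
move=> a0; have [N aN] := lcoef_bounded a.
have /existsNP[t /eqP at0] : ~ forall t, a t = 0.
  by move=> a0'; case/eqP: a0; apply: laurentP => t; rewrite a0'.
have exk : exists k : nat, a (N + k%:Z) != 0.
  exists `|t - N|%N; case: (ltP t N) => [/aN/eqP|Nt]; first by rewrite (negPf at0).
  by rewrite (_ : N + _ = t)//; lia.
case: (ex_minnP exk) => k ak kmin; exists (N + k%:Z); split=> // u uk.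
case: (ltP u N) => [/aN//|Nu].
apply: contrapT => /eqP au; have := kmin `|u - N|%N.
by rewrite (_ : N + _ = u); [move=> /(_ au); lia | lia].
Qed.

Lemma order_unique (F : fieldType) (a : laurent F) (i j : int) :
  is_order a i -> is_order a j -> i = j.
Proof.
move=> [ai ilt] [aj jlt]; case: (ltgtP i j) => // [/jlt|/ilt] /eqP.
  by rewrite (negPf ai).
by rewrite (negPf aj).
Qed.

Fixpoint linv_seq (F : fieldType) (c : nat -> F) (n : nat) : seq F :=
  if n is n'.+1 then
    let s := linv_seq c n' in
    rcons s ((c 0%N)^-1 * ((n' == 0%N)%:R - \sum_(j < n') c j.+1 * s`_(n' - j.+1)))
  else [::].

Lemma size_linv_seq (F : fieldType) (c : nat -> F) n : size (linv_seq c n) = n.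
Proof. by elim: n => //= n IH; rewrite size_rcons IH. Qed.

Lemma nth_linv_seq (F : fieldType) (c : nat -> F) n i :
  (i < n)%N -> (linv_seq c n)`_i = (linv_seq c i.+1)`_i.
Proof.
elim: n => // n IH; rewrite ltnS leq_eqVlt => /orP[/eqP->//|ltin].
by rewrite -IH//= nth_rcons size_linv_seq ltin.
Qed.

Lemma linv_exists (F : fieldType) (a : laurent F) : a != 0 -> exists b, b * a = 1.
Proof.
move=> /order_exists[N [aN0 aN]].
pose c (k : nat) := a (N + k%:Z).
pose d (k : nat) := (linv_seq c k.+1)`_k.
pose bc (t : int) := if t < - N then 0 else d `|(t + N)%R|%N.
have bcP : exists M : int, forall t : int, t < M -> bc t = 0.
  by exists (- N) => t tN; rewrite /bc tN.
exists (Laurent bcP); rewrite mulrC; apply: laurentP => t.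
have bN u : u < - N -> bc u = 0 by move=> uN; rewrite /bc uN.
rewrite lcoefM -/(lconv a bc t); case: (ltP t 0) => [t0|t0].
  rewrite (lconv_lt aN bN) ?addrN//= ltW// coef1.
  by rewrite (_ : (`|t|%N == 0%N) = false)//; lia.
have -> : t = N + - N + `|t|%N%:Z by lia.
rewrite (lconvE _ aN bN); set k := `|t|%N.
rewrite -/(c _) big_ord_recl.
have dE (i : nat) : bc (- N + i%:Z) = d i.
  by rewrite /bc ifF; [congr d|]; lia.
rewrite addr0 dE subn0 {1}/d /= nth_rcons size_linv_seq ltnn eqxx.
have c0 : c 0%N = a N by rewrite /c addr0.
rewrite c0 mulVKf// -[X in _ + X](_ : \sum_(j < k) c j.+1 * (linv_seq c k)`_(k - j.+1) = _).
  rewrite addrNK subrr add0r.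
  by case: (k) => [|k']/=; rewrite ?coef1.
apply: eq_bigr => j _; rewrite dE /= nth_linv_seq//.
by have := ltn_ord j; rewrite /bump /=; lia.
Qed.

Definition linv (F : fieldType) (a : laurent F) : laurent F :=
  xget 0 [set b | b * a = 1].

Fact lmulVf (F : fieldType) (a : laurent F) : a != 0 -> linv a * a = 1.
Proof. by move=> /linv_exists; apply: xgetPex. Qed.

Fact linv0 (F : fieldType) : linv (0 : laurent F) = 0.
Proof.
apply: xgetPN => b /=; rewrite mulr0 => /esym/eqP.
by rewrite (negPf (oner_neq0 _)).
Qed.

HB.instance Definition _ (F : fieldType) :=
  GRing.ComNzRing_isField.Build (laurent F) (@lmulVf F) (@linv0 F).

(* The valuation of a; it is +oo exactly at 0, and -oo is never taken.        *)
Definition lorder (F : fieldType) (a : laurent F) : int :=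
  xget 0 [set i | is_order a i].

Definition lval (F : fieldType) (a : laurent F) : \bar int :=
  if a == 0 then +oo%E else (lorder a)%:E%E.

Lemma lorderP (F : fieldType) (a : laurent F) : a != 0 -> is_order a (lorder a).
Proof. by move=> /order_exists; apply: xgetPex. Qed.

(* The polynomial part: when nonzero it has degree - lorder a, so that the    *)
(* bound on the number of coefficients is large enough.                       *)
Definition lfloor (F : fieldType) (a : laurent F) : {poly F} :=
  \poly_(i < `|lorder a|.+1) a (- i%:Z).

Lemma coef_lfloor (F : fieldType) (a : laurent F) (i : nat) :
  (lfloor a)`_i = a (- i%:Z).
Proof.
rewrite coef_poly; case: ltnP => // ai.
have [->//|a0] := eqVneq a 0.
by have [_ ->//] := lorderP a0; move: (lorder a) ai => N; lia.
Qed.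

(* The dimension m >= 1 is n.+1, and the index set {1, ..., m} is 'I_n.+1, in *)
(* which ord0 stands for 1.                                                   *)
Definition vval (F : fieldType) (n : nat) (r : 'cV[laurent F]_n.+1) : \bar int :=
  \big[Order.min/+oo%E]_(i < n.+1) lval (r i 0).

Definition Iv (F : fieldType) (n : nat) (r : 'cV[laurent F]_n.+1) :
    'I_n.+1 * \bar int :=
  ([arg min_(i < ord0 | lval (r i ord0) == vval r) (i : nat)]%N, vval r).

Lemma Iv0 (F : fieldType) (n : nat) :
  Iv (0 : 'cV[laurent F]_n.+1) = (ord0, +oo%E).
Proof.
have v0 : vval (0 : 'cV[laurent F]_n.+1) = +oo%E.
  rewrite /vval; elim/big_ind: _ => // [x y -> ->|i _]; first exact: minxx.
  by rewrite mxE /lval eqxx.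
rewrite /Iv v0; congr pair; case: arg_minnP.
  by rewrite mxE /lval eqxx.
move=> i _ /(_ ord0); rewrite mxE /lval eqxx => /(_ isT).
by rewrite leqn0 => /eqP i0; apply: val_inj.
Qed.

Definition ivlt (n : nat) (x y : 'I_n.+1 * \bar int) : bool :=
  (x.2 < y.2)%E || ((x.2 == y.2) && (x.1 < y.1)%N).
Definition ivle (n : nat) (x y : 'I_n.+1 * \bar int) : bool :=
  ivlt x y || (x == y).

Definition ratio_vec (F : fieldType) (n : nat) (p : 'cV[{poly F}]_n.+1)
    (q : {poly F}) : 'cV[laurent F]_n.+1 :=
  (lpoly q)^-1 *: map_mx (@lpoly F) p.

(* The degree, for nonzero polynomials.                                       *)
Definition deg (F : fieldType) (p : {poly F}) : nat := (size p).-1.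

Definition precision (F : fieldType) (n : nat) (r : 'cV[laurent F]_n.+1)
    (q : {poly F}) : 'I_n.+1 * \bar int :=
  Iv (r - ratio_vec (map_mx (@lfloor F) (lpoly q *: r)) q).

Definition best_approximant (F : fieldType) (n : nat) (r : 'cV[laurent F]_n.+1)
    (p : 'cV[{poly F}]_n.+1) (q : {poly F}) : Prop :=
  [/\ q != 0,
      forall q' : {poly F}, q' != 0 -> (deg q' < deg q)%N ->
        ivlt (precision r q') (Iv (r - ratio_vec p q))
    & forall q' : {poly F}, q' != 0 -> deg q' = deg q ->
        ivle (precision r q') (Iv (r - ratio_vec p q))].

Definition best_denominator (F : fieldType) (n : nat) (r : 'cV[laurent F]_n.+1)
    (q : {poly F}) : Prop :=
  exists p : 'cV[{poly F}]_n.+1, best_approximant r p q.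

(* [pcf_len = None] is the infinite length. The values of [pcf_a] at indices  *)
(* outside of the length, and of [pcf_h] there and at 0, are irrelevant.      *)
Record precf (F : fieldType) (n : nat) := PreCF {
  pcf_len : option nat;
  pcf_h : nat -> 'I_n.+1;
  pcf_a : nat -> 'cV[{poly F}]_n.+1;
  pcf_len_gt0 : pcf_len != Some 0%N;
  pcf_a0 : pcf_a 0%N = 0
}.

Definition in_len (F : fieldType) (n : nat) (C : precf F n) (k : nat) : bool :=
  if pcf_len C is Some w then (k < w)%N else true.

Definition Emx (F : fieldType) (n : nat) (h : 'I_n.+1) : 'M[{poly F}]_(n.+1 + 1) :=
  xcol (lshift 1 h) (rshift n.+1 ord0) 1%:M.

Definition Amx (F : fieldType) (n : nat) (a : 'cV[{poly F}]_n.+1) :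
    'M[{poly F}]_(n.+1 + 1) :=
  block_mx 1%:M a 0 1%:M.

Fixpoint Bmx (F : fieldType) (n : nat) (C : precf F n) (k : nat) :
    'M[{poly F}]_(n.+1 + 1) :=
  if k is k'.+1 then Bmx C k' *m Emx F (pcf_h C k) *m Amx (pcf_a C k) else 1%:M.

Definition conv_p (F : fieldType) (n : nat) (C : precf F n) (k : nat) :
    'cV[{poly F}]_n.+1 := ursubmx (Bmx C k).
Definition conv_q (F : fieldType) (n : nat) (C : precf F n) (k : nat) :
    {poly F} := drsubmx (Bmx C k) 0 0.

Definition cf_t (F : fieldType) (n : nat) (C : precf F n) (k : nat) : nat :=
  deg (pcf_a C k (pcf_h C k) 0).
Definition cf_v (F : fieldType) (n : nat) (C : precf F n) (k : nat) (j : 'I_n.+1) :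
    nat := (\sum_(1 <= i < k.+1 | pcf_h C i == j) cf_t C i)%N.
Definition cf_d (F : fieldType) (n : nat) (C : precf F n) (k : nat) : nat :=
  (\sum_(1 <= i < k.+1) cf_t C i)%N.

(* [cf_d], extended by d_w = +oo when the length w is finite.                 *)
Definition cf_dbar (F : fieldType) (n : nat) (C : precf F n) (k : nat) : \bar int :=
  if in_len C k then ((cf_d C k)%:Z)%:E%E else +oo%E.

(* z^-1 is written (lpoly 'X)^-1.                                             *)
Definition cf_D (F : fieldType) (n : nat) (C : precf F n) (k : nat) :
    'M[laurent F]_n.+1 :=
  diag_mx (\row_j (lpoly 'X) ^- cf_v C k j).

Definition cond1 (F : fieldType) (n : nat) (C : precf F n) : Prop :=
  forall k, (1 <= k)%N -> in_len C k -> (1 <= cf_t C k)%N.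

Definition cond2 (F : fieldType) (n : nat) (C : precf F n) : Prop :=
  forall k, (1 <= k)%N -> in_len C k.+1 ->
    ivlt (pcf_h C k, ((cf_v C k.-1 (pcf_h C k))%:Z)%:E%E)
         (pcf_h C k.+1, ((cf_v C k.+1 (pcf_h C k.+1))%:Z)%:E%E).

Definition cond3 (F : fieldType) (n : nat) (C : precf F n) : Prop :=
  forall k, (1 <= k)%N -> in_len C k ->
    Iv (cf_D C k *m map_mx (@lpoly F) (pcf_a C k)) =
    (pcf_h C k, ((cf_v C k.-1 (pcf_h C k))%:Z)%:E%E).

Definition is_cf (F : fieldType) (n : nat) (C : precf F n) : Prop :=
  [/\ cond1 C, cond2 C & cond3 C].

Definition lcvg (F : fieldType) (n : nat) (u : nat -> 'cV[laurent F]_n.+1)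
    (l : 'cV[laurent F]_n.+1) : Prop :=
  forall N : int, exists K : nat, forall k, (K <= k)%N -> (N%:E <= vval (u k - l))%E.

Definition llim (F : fieldType) (n : nat) (u : nat -> 'cV[laurent F]_n.+1) :
    'cV[laurent F]_n.+1 := xget 0 [set l | lcvg u l].

Definition cf_value (F : fieldType) (n : nat) (C : precf F n) : 'cV[laurent F]_n.+1 :=
  if pcf_len C is Some w then ratio_vec (conv_p C w.-1) (conv_q C w.-1)
  else llim (fun k => ratio_vec (conv_p C k) (conv_q C k)).

(* Main.v *)
(* Write m = n + 1 and read a pair (j, t) of an index (from 0) and a valuation
   as the integer t m + j: the order on pairs becomes the order on integers,
   and scaling a vector by a series of valuation i shifts Iv by i m. In this
   encoding Iv (r - p_k / q_k) is kappa_(k+1), which is (h_(k+1), v_(k+1) + d_k)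
   and increases with k by Condition 2; so the errors q r - p of the first m
   columns (p, q) of B_k are led by (j, v_(k,j)), i.e. lie in distinct classes
   mod m, and cannot cancel in a combination with polynomial coefficients.
   Given p / q with deg q < d_(k+1), expand (p, q) along the columns of the
   unimodular B_(k+1): an error beyond kappa_(k+1) would bound every term of
   that expansion and force the degree of q to be both small and large. *)

Require Import Defs.
From mathcomp Require Import all_boot all_order all_algebra perm.
From mathcomp Require Import boolp classical_sets constructive_ereal.
From mathcomp Require Import zify ring.

Set Implicit Arguments.
Unset Strict Implicit.
Unset Printing Implicit Defensive.

Import Order.TTheory GRing.Theory Num.Theory.
Local Open Scope ring_scope.

(** * Integer encoding of pairs, and orders of products and inverses of series *)

Definition key (n : nat) (j : 'I_n.+1) (t : int) : int := t * n.+1%:Z + (j : nat)%:Z.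

Lemma key_ltE (n : nat) (j h : 'I_n.+1) (t v : int) :
  (key j t < key h v) = (t < v) || ((t == v) && (j < h)%N).
Proof.
rewrite /key; have := ltn_ord j; have := ltn_ord h.
case: (ltgtP t v) => /= [tv|vt|->] jn hn; last by lia.
- by nia.
- by apply/negbTE; nia.
Qed.

Lemma key_inj (n : nat) (j h : 'I_n.+1) (t v : int) :
  key j t = key h v -> j = h /\ t = v.
Proof.
move=> E; have := key_ltE j h t v; have := key_ltE h j v t.
rewrite E !ltxx; case: (ltgtP t v) => //= ->.
case: (ltngtP j h) => //= jh _ _; split=> //; exact: val_inj.
Qed.

Lemma keyD (n : nat) (j : 'I_n.+1) (t u : int) :
  key j (t + u) = key j t + u * n.+1%:Z.
Proof. by rewrite /key; lia. Qed.

Lemma is_orderM (F : fieldType) (a b : laurent F) (i j : int) :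
  is_order a i -> is_order b j -> is_order (a * b) (i + j).
Proof.
move=> [ai alow] [bj blow]; split; last by move=> t; apply: lmul_lt.
have := lconvE 0 alow blow; rewrite addr0 big_ord1 /= !addr0 => E.
by change (lconv a b (i + j) != 0); rewrite E mulf_neq0.
Qed.

Lemma is_order_neq0 (F : fieldType) (a : laurent F) (i : int) :
  is_order a i -> a != 0.
Proof. by case=> ai _; apply: contraNneq ai => ->. Qed.

Lemma is_order_lpoly (F : fieldType) (p : {poly F}) :
  p != 0 -> is_order (lpoly p) (- (deg p)%:Z).
Proof.
move=> p0; rewrite /deg; split=> [|t tp].
  by rewrite lcoef_poly ifT ?abszN /= ?lead_coef_eq0//; lia.
rewrite lcoef_poly; case: ifP => // t0; apply: nth_default.
by move: (size p) tp => s; lia.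
Qed.

Lemma is_orderV (F : fieldType) (a : laurent F) (i : int) :
  is_order a i -> is_order a^-1 (- i).
Proof.
move=> ai; have a0 := is_order_neq0 ai.
have [|j aj] := @order_exists _ a^-1; first by rewrite invr_eq0.
have := is_orderM ai aj; rewrite divff// => o1.
have o0 := is_order_lpoly (oner_neq0 {poly F}); rewrite /deg size_poly1 rmorph1 in o0.
have := order_unique o0 o1; rewrite /= => ij.
by rewrite (_ : - i = j)//; lia.
Qed.

(** * Leading positions of vectors of Laurent series *)

Section Vectors.
Variables (F : fieldType) (n : nat).
Implicit Types (x y : 'cV[laurent F]_n.+1) (s u : int).
Local Notation M := (n.+1%:Z).

(** In the encoding by [key], [vlow x s] means that [Iv x] is at least [s], and [vlead x s] that it
    equals [s]. The zero vector satisfies every [vlow] and no [vlead], so no infinite value has to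
    be encoded. *)
Definition vlow x s : Prop := forall j t, key j t < s -> x j 0 t = 0.
Definition vlead x s : Prop := vlow x s /\ ~ vlow x (s + 1).

Lemma vlow_le x s u : vlow x s -> u <= s -> vlow x u.
Proof. by move=> xs us j t ju; apply: xs; lia. Qed.

Lemma vlow0 s : vlow 0 s. Proof. by move=> j t _; rewrite mxE. Qed.

Lemma vlowD x y s : vlow x s -> vlow y s -> vlow (x + y) s.
Proof. by move=> xs ys j t jt; rewrite mxE lcoefD xs// ys// addr0. Qed.

Lemma vlowN x s : vlow x s -> vlow (- x) s.
Proof. by move=> xs j t jt; rewrite mxE lcoefN xs// oppr0. Qed.

Lemma vlow_sum (I : finType) (P : pred I) (x : I -> 'cV[laurent F]_n.+1) s :
  (forall i, P i -> vlow (x i) s) -> vlow (\sum_(i | P i) x i) s.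
Proof. by move=> xs; elim/big_ind: _ => //; [exact: vlow0|move=> *; exact: vlowD]. Qed.

Lemma vleadE x s u : vlead x s -> vlow x u <-> u <= s.
Proof.
move=> [xs xs1]; split=> [xu|/(vlow_le xs)//].
by rewrite leNgt; apply/negP => su; apply/xs1/(vlow_le xu); lia.
Qed.

Lemma vleadDr x y s : vlead x s -> vlow y (s + 1) -> vlead (x + y) s.
Proof.
move=> [xs xs1] ys; split; first by apply: vlowD => //; apply: vlow_le ys _; lia.
by move=> /vlowD/(_ (vlowN ys)); rewrite addrK.
Qed.

Lemma vleadN x s : vlead x s -> vlead (- x) s.
Proof. by move=> [xs xs1]; split; [exact: vlowN|move=> /vlowN; rewrite opprK]. Qed.

Lemma vlow_scale (c : laurent F) i x s :
  is_order c i -> vlow x s -> vlow (c *: x) (s + i * M).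
Proof.
move=> [_ clow] xs j t jt; rewrite mxE.
apply: (@lmul_lt _ _ _ i (t - i + 1) t clow); last by lia.
by move=> u ut; apply: xs; rewrite /key in jt *; nia.
Qed.

Lemma vlow_scaleE (c : laurent F) i x s :
  is_order c i -> vlow (c *: x) s <-> vlow x (s - i * M).
Proof.
move=> ci; split=> [/(vlow_scale (is_orderV ci))|/(vlow_scale ci)].
  by rewrite scalerA mulVf ?(is_order_neq0 ci)// scale1r mulNr.
by rewrite subrK.
Qed.

Lemma vlead_scale (c : laurent F) i x s :
  is_order c i -> vlead x s -> vlead (c *: x) (s + i * M).
Proof.
move=> ci [xs xs1]; split; first exact: vlow_scale.
by rewrite (vlow_scaleE _ _ ci) addrAC addrK.
Qed.

Lemma vlead_key x h v :
  (forall j t, key j t < key h v -> x j 0 t = 0) -> x h 0 v != 0 ->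
  vlead x (key h v).
Proof.
move=> xlow xh; split=> // xs1; move/negP: xh; apply; apply/eqP; apply: xs1; lia.
Qed.

(** The term with the least lead is the only one with that lead, so nothing cancels it and it leads
    the whole sum. A lower bound on the sum is thus a lower bound on every term. *)
Lemma vlow_sum_lead (I : finType) (P : pred I) (x : I -> 'cV[laurent F]_n.+1)
    (s : I -> int) u :
  (forall i, P i -> vlead (x i) (s i)) ->
  (forall i j, P i -> P j -> s i = s j -> i = j) ->
  vlow (\sum_(i | P i) x i) u -> forall i, P i -> u <= s i.
Proof.
move=> xs sinj xu i Pi.
case: (@Order.TotalTheory.arg_minP _ _ _ i P s Pi) => k Pk kmin.
apply: le_trans (kmin i Pi); rewrite -vleadE//.
  exact: xu.
rewrite (bigD1 k)//=; apply: vleadDr; first exact: xs.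
apply: vlow_sum => j /andP[Pj jk]; have [xj _] := xs j Pj.
apply: vlow_le xj _; have := kmin j Pj.
rewrite le_eqVlt => /predU1P[/sinj E|]; last by lia.
by rewrite -E ?eqxx in jk.
Qed.

(** * Translation between [Iv] and leading positions *)

Lemma lval_ge (a : laurent F) (v : int) :
  (v%:E <= lval a)%E <-> forall t, t < v -> a t = 0.
Proof.
rewrite /lval; case: eqVneq => [->|a0]; first by split=> // _; rewrite leey.
have [al alow] := lorderP a0; rewrite lee_fin; split=> [va t tv|H].
  by apply: alow; lia.
by rewrite leNgt; apply/negP => /H/eqP; rewrite (negPf al).
Qed.

Lemma vval_ge x (v : int) :
  (v%:E <= vval x)%E <-> forall j t, t < v -> x j 0 t = 0.
Proof.
rewrite /vval; split=> [/bigmin_geP[_ H] j|H]; first exact/lval_ge/H.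
by apply/bigmin_geP; split=> [|j _]; [rewrite leey|exact/lval_ge/H].
Qed.

Lemma Iv_cases x :
  (x = 0 /\ Iv x = (ord0, +oo%E)) \/
  exists h v, Iv x = (h, v%:E%E) /\ vlead x (key h v).
Proof.
have [->|x0] := eqVneq x 0; [by left; split=> //; exact: Iv0|right].
have [k _ kE] : {k | k \in predT & vval x = lval (x k 0)}.
  by apply: (eq_bigmin ord0) => // i _; exact: leey.
have [i xi] : exists i, x i 0 != 0.
  apply/existsP; apply: contraNT x0 => /existsPn x0.
  by apply/eqP/colP => i; rewrite mxE; apply/eqP/negPn/x0.
have [v vE] : exists v, vval x = v%:E%E.
  have : (vval x <= lval (x i 0%R))%E by apply: bigmin_le_cond.
  rewrite kE /lval (negPf xi); case: eqP => [_|_ _]; first by rewrite leye_eq.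
  by eexists.
(* The minimum in [Iv] has the default [ord0], which need not attain the valuation. The default is
   never reached, because the index [k] does attain it. *)
rewrite /Iv /arg_min /extremum; case: pickP => [h|]; last first.
  case: (@arg_minnP _ k [pred i | lval (x i 0) == vval x] val) => [/=|j Pj jmin].
    by rewrite kE.
  move=> /(_ j)/negP[]; apply/andP; split=> //.
  by apply/forallP => i'; apply/implyP/jmin.
move=> /andP[/= /eqP hE /forallP hmin]; exists h, v; split; first by rewrite vE.
have xlt j t : t < v -> x j 0 t = 0.
  by apply: (vval_ge x v).1; rewrite vE.
have lvalE j : x j 0 v != 0 -> lval (x j 0) = v%:E%E.
  move=> xj; rewrite /lval; case: eqVneq => [x0'|xj0].
    by rewrite x0' eqxx in xj.
  congr EFin; apply: (order_unique (lorderP xj0)); split=> // t; exact: xlt.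
apply: vlead_key => [j t|].
  rewrite key_ltE => /orP[/xlt//|/andP[/eqP -> jh]].
  apply: contraTeq jh => /lvalE xj; rewrite -leqNgt.
  by have /implyP := hmin j; apply; rewrite xj vE.
rewrite vE /lval in hE; case: eqVneq hE => // xh0 [<-].
by have [] := lorderP xh0.
Qed.

Lemma ivleNgt (a b : 'I_n.+1 * \bar int) : ivle a b = ~~ ivlt b a.
Proof.
case: a b => [i a] [j b]; rewrite /ivle /ivlt /= xpair_eqE.
case: (ltgtP a b) => //= _; rewrite ?andbF ?orbF ?andbT//.
by rewrite -leqNgt [RHS]leq_eqVlt orbC.
Qed.

(** Comparing sets of lower bounds instead of values treats the zero vector, whose [Iv] is the
    largest, on the same footing as the others. *)
Lemma ivleP x y : ivle (Iv x) (Iv y) <-> forall s, vlow x s -> vlow y s.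
Proof.
rewrite ivleNgt /ivlt.
case: (Iv_cases x) => [[-> ->]|[h [v [-> xl]]]];
  case: (Iv_cases y) => [[-> ->]|[h' [v' [-> yl]]]] /=.
- by [].
- rewrite ltey; split=> // /(_ (key h' v' + 1) (@vlow0 _)).
  by case: yl.
- by split=> // _ s _; exact: vlow0.
- rewrite lte_fin eqe -key_ltE -leNgt; split=> [hv s|/(_ (key h v))].
    by rewrite (vleadE _ xl) (vleadE _ yl) => /le_trans; apply.
  by rewrite (vleadE _ xl) (vleadE _ yl); apply.
Qed.

Lemma ivltP x y : ivlt (Iv x) (Iv y) <-> exists2 s, vlow y s & ~ vlow x s.
Proof.
rewrite -[ivlt _ _]negbK -ivleNgt; split.
  move=> /negP/ivleP/existsNP[s /not_implyP[ys xs]]; by exists s.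
by move=> [s ys xs]; apply/negP => /ivleP/(_ s ys).
Qed.

Lemma Iv_key x h v : Iv x = (h, v%:E%E) -> vlead x (key h v).
Proof. by case: (Iv_cases x) => [[_ ->]//|[h' [v' [-> xl]]] [<- <-]]. Qed.

End Vectors.

(** * Columns of [Bmx], their errors and recurrences *)

Section Columns.
Variables (F : fieldType) (n : nat).
Implicit Types (x y : 'cV[{poly F}]_(n.+1 + 1)) (r : 'cV[laurent F]_n.+1).

(** A column stacks a numerator p over a denominator q, and [err] is q r - p. Unlike r - p / q it is
    linear over F[z] in the column, hence compatible with expansions along the columns of [Bmx]. *)
Definition den x : {poly F} := dsubmx x 0 0.

Definition err r x : 'cV[laurent F]_n.+1 :=
  lpoly (den x) *: r - map_mx (@lpoly F) (usubmx x).

Lemma denD x y : den (x + y) = den x + den y.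
Proof. by rewrite /den !mxE. Qed.

Lemma denZ c x : den (c *: x) = c * den x.
Proof. by rewrite /den !mxE. Qed.

Lemma den_sum (I : finType) (x : I -> 'cV[{poly F}]_(n.+1 + 1)) :
  den (\sum_i x i) = \sum_i den (x i).
Proof. by rewrite /den mxE summxE; apply: eq_bigr => i _; rewrite !mxE. Qed.

Lemma errD r x y : err r (x + y) = err r x + err r y.
Proof.
by apply/colP => i; rewrite /err denD !mxE !rmorphD /=; ring.
Qed.

Lemma errZ r c x : err r (c *: x) = lpoly c *: err r x.
Proof.
by apply/colP => i; rewrite /err denZ !mxE !rmorphM /=; ring.
Qed.

Lemma err_sum r (I : finType) (x : I -> 'cV[{poly F}]_(n.+1 + 1)) :
  err r (\sum_i x i) = \sum_i err r (x i).
Proof.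
elim/big_rec2: _ => [|i y1 y2 _ <-]; last by rewrite errD.
by apply/colP => i; rewrite /err /den !mxE !rmorph0 mul0r subr0.
Qed.

Lemma errE r x : den x != 0 ->
  err r x = lpoly (den x) *: (r - ratio_vec (usubmx x) (den x)).
Proof.
move=> x0; rewrite /err /ratio_vec scalerBr scalerA divff ?scale1r//.
by rewrite -(rmorph0 (@lpoly F)) (inj_eq (@lpoly_inj F)).
Qed.

Lemma err_ratio r x : den x != 0 ->
  r - ratio_vec (usubmx x) (den x) = (lpoly (den x))^-1 *: err r x.
Proof.
move=> x0; rewrite errE// scalerA mulVf ?scale1r//.
by rewrite -(rmorph0 (@lpoly F)) (inj_eq (@lpoly_inj F)).
Qed.

Variable C : precf F n.
Local Notation h := (pcf_h C).
Local Notation a := (pcf_a C).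

Definition ccol k (j : 'I_n.+1) : 'cV[{poly F}]_(n.+1 + 1) :=
  col (lshift 1 j) (Bmx C k).
Definition lcol k : 'cV[{poly F}]_(n.+1 + 1) := col (rshift n.+1 0) (Bmx C k).

Lemma conv_pE k : conv_p C k = usubmx (lcol k).
Proof. by apply/colP => i; rewrite !mxE. Qed.

Lemma conv_qE k : conv_q C k = den (lcol k).
Proof. by rewrite /conv_q /den !mxE. Qed.

Lemma BmxS k : Bmx C k.+1 = Bmx C k *m Emx F (h k.+1) *m Amx (a k.+1).
Proof. by []. Qed.

Lemma mulmx_EmxE (B : 'M[{poly F}]_(n.+1 + 1)) i :
  B *m Emx F i = xcol (lshift 1 i) (rshift n.+1 0) B.
Proof. by rewrite /Emx !xcolE mul1mx. Qed.

Lemma mulmx_AmxE (B : 'M[{poly F}]_(n.+1 + 1)) (b : 'cV[{poly F}]_n.+1) :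
  B *m Amx b = row_mx (lsubmx B) (lsubmx B *m b + rsubmx B).
Proof.
by rewrite -{1}(hsubmxK B) /Amx mul_row_block !mulmx1 mulmx0 addr0.
Qed.

(** [Emx] exchanges column [h k.+1] with the last one, and [Amx] then alters the last column
    only. *)
Lemma ccolS k j : ccol k.+1 j = if j == h k.+1 then lcol k else ccol k j.
Proof.
apply/colP => i; rewrite /ccol /lcol BmxS mulmx_AmxE mulmx_EmxE.
rewrite mxE row_mxEl mxE mxE; case: eqVneq => [->|jh].
  by rewrite tpermL [RHS]mxE.
by rewrite tpermD ?[RHS]mxE// eq_sym ?(inj_eq (@lshift_inj _ _))// eq_lrshift.
Qed.

Lemma lcolS k :
  lcol k.+1 = \sum_j a k.+1 j 0 *: ccol k.+1 j + ccol k (h k.+1).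
Proof.
apply/colP => i; rewrite /lcol BmxS mulmx_AmxE.
rewrite mxE row_mxEr mxE mxE [RHS]mxE summxE; congr (_ + _).
  apply: eq_bigr => j _; rewrite /ccol BmxS mulmx_AmxE.
  by rewrite [in RHS]mxE [in RHS]mxE row_mxEl mulrC.
by rewrite mulmx_EmxE !mxE tpermR.
Qed.

Lemma Bmx_unit k : Bmx C k \in unitmx.
Proof.
elim: k => [|k IH]; first exact: unitmx1.
rewrite BmxS !unitmx_mul IH /=; apply/andP; split.
  by rewrite /Emx xcolE mul1mx unitmx_perm.
by rewrite unitmxE /Amx det_ublock !det1 mulr1 unitr1.
Qed.

Lemma col_span k x : exists c c0,
  x = \sum_j c j *: ccol k j + c0 *: lcol k.
Proof.
have [y xy] : exists y, x = Bmx C k *m y.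
  by exists (invmx (Bmx C k) *m x); rewrite mulKVmx ?Bmx_unit.
exists (fun j => y (lshift 1 j) 0), (y (rshift n.+1 0) 0).
rewrite {}xy; apply/colP => i; rewrite [RHS]mxE summxE mxE big_split_ord /= big_ord1.
by congr (_ + _); [apply: eq_bigr => j _|];
  rewrite [in RHS]mxE mulrC [col _ _ _ _]mxE ?ord1.
Qed.

Lemma cf_vS k j :
  cf_v C k.+1 j = (cf_v C k j + (if j == h k.+1 then cf_t C k.+1 else 0))%N.
Proof. by rewrite /cf_v !(big_mkcond (fun i => h i == j)) big_nat_recr//= eq_sym. Qed.

Lemma cf_v0 j : cf_v C 0 j = 0%N. Proof. by rewrite /cf_v big_geq. Qed.

Lemma cf_dS k : cf_d C k.+1 = (cf_d C k + cf_t C k.+1)%N.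
Proof. by rewrite /cf_d big_nat_recr. Qed.

Lemma cf_d0 : cf_d C 0 = 0%N. Proof. by rewrite /cf_d big_geq. Qed.

Lemma col_cases k j :
  [/\ den (ccol k j) = 0, cf_v C k j = 0%N & forall r, err r (ccol k j) = - delta_mx j 0]
  \/ (exists i, [/\ (i < k)%N, ccol k j = lcol i, h i.+1 = j
                   & cf_v C k j = cf_v C i.+1 j]).
Proof.
elim: k => [|k IH].
  left; rewrite cf_v0.
  have d0 : den (ccol 0 j) = 0 by rewrite /den !mxE eq_rlshift.
  split=> // r; rewrite /err d0 rmorph0 scale0r sub0r; congr (- _).
  apply/colP => i; rewrite !mxE (inj_eq (@lshift_inj _ _)) eqxx andbT.
  by rewrite rmorph_nat.
rewrite ccolS; case: eqVneq => [->|jh].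
  by right; exists k.
rewrite cf_vS (negPf jh) addn0; case: IH => [IH|[i [ik -> hi ->]]]; first by left.
by right; exists i; split=> //; exact: ltnW.
Qed.

End Columns.

(** * Degrees of the denominators and errors between convergents *)

Section Convergents.
Variables (F : fieldType) (n : nat) (C : precf F n).
Hypothesis cfC : is_cf C.
Local Notation M := (n.+1%:Z).
Local Notation h := (pcf_h C).
Local Notation a := (pcf_a C).
Local Notation v := (cf_v C).
Local Notation d := (cf_d C).

Definition convergent k : 'cV[laurent F]_n.+1 :=
  ratio_vec (conv_p C k) (conv_q C k).

(* [kappa 0] is junk: [h 0] is unspecified. *)
Definition kappa k : int := key (h k) (v k (h k) + d k.-1)%N%:Z.

Lemma in_lenW k l : (k <= l)%N -> in_len C l -> in_len C k.
Proof. by rewrite /in_len; case: (pcf_len C) => // w; exact: leq_ltn_trans. Qed.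

Lemma in_len0 : in_len C 0.
Proof. by rewrite /in_len; case: (pcf_len C) (pcf_len_gt0 C) => // -[]. Qed.

Lemma cf_d_lt k : in_len C k.+1 -> (d k < d k.+1)%N.
Proof. by move=> kC; rewrite cf_dS -addn1 leq_add2l; case: cfC => c1 _ _; apply: c1. Qed.

Lemma cf_d_mono k l : (k <= l)%N -> (d k <= d l)%N.
Proof.
by move=> /subnKC<-; elim: (l - k)%N => [|i IH]; rewrite ?addn0// addnS cf_dS; lia.
Qed.

Lemma cf_d_ge k : in_len C k -> (k <= d k)%N.
Proof.
elim: k => // k IH kC; apply: leq_ltn_trans (cf_d_lt kC).
exact: IH (in_lenW (leqnSn _) kC).
Qed.

(** Step [k.+1] adds the same [cf_t] to [cf_v] at [h k.+1] and to [cf_d], so it can be charged to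
    either one. Taking this form at one index and the next form at the following index gives both
    the same [cf_d], and what remains to compare is exactly Condition 2. *)
Lemma kappaE k : kappa k.+1 = key (h k.+1) (v k (h k.+1)) + (d k.+1)%:Z * M.
Proof. by rewrite /kappa /= -keyD cf_vS eqxx cf_dS; congr key; lia. Qed.

Lemma kappaE' k : kappa k.+1 = key (h k.+1) (v k.+1 (h k.+1)) + (d k)%:Z * M.
Proof. by rewrite /kappa /= -keyD PoszD. Qed.

Lemma kappaS_lt k : in_len C k.+2 -> kappa k.+1 < kappa k.+2.
Proof.
move=> kC; rewrite kappaE kappaE' ltrD2r key_ltE.
by case: cfC => _ /(_ k.+1 isT kC) c2 _.
Qed.

Lemma kappa_lt i k : (i < k)%N -> in_len C k.+1 -> kappa i.+1 < kappa k.+1.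
Proof.
elim: k => // k IH; rewrite ltnS leq_eqVlt => /predU1P[->|ik] kC.
  exact: kappaS_lt.
by apply: lt_trans (kappaS_lt kC); apply: IH (in_lenW _ kC).
Qed.

Lemma kappa_le i k : (i <= k)%N -> in_len C k.+1 -> kappa i.+1 <= kappa k.+1.
Proof. by rewrite leq_eqVlt => /predU1P[->//|ik] kC; apply/ltW/kappa_lt. Qed.

Lemma kappa_ge k : in_len C k.+1 -> k%:Z * M <= kappa k.+1.
Proof.
move=> kC; rewrite kappaE; have := cf_d_ge kC.
rewrite /key; move: (v _ _) (d _) => v' d' kd.
have : k%:Z * M <= d'%:Z * M by nia.
by have : 0 <= v'%:Z * M by []; lia.
Qed.

Lemma a_lead_neq0 k : in_len C k.+1 -> a k.+1 (h k.+1) 0 != 0.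
Proof.
move=> kC; have [c1 _ _] := cfC; have := c1 k.+1 isT kC; rewrite /cf_t /deg.
by apply: contraTneq => ->; rewrite size_poly0.
Qed.

(** Component [j] of the vector in Condition 3 has order [v k.+1 j] minus the degree of the entry,
    and it cannot lie before the prescribed [Iv]. *)
Lemma deg_a_le k j : in_len C k.+1 -> a k.+1 j 0 != 0 ->
  key (h k.+1) (v k (h k.+1)) <= key j (v k.+1 j) - (deg (a k.+1 j 0))%:Z * M.
Proof.
move=> kC aj; have [_ _ /(_ k.+1 isT kC)] := cfC.
move=> /Iv_key[low _].
pose o := (v k.+1 j)%:Z - (deg (a k.+1 j 0))%:Z.
have oE : is_order ((cf_D C k.+1 *m map_mx (@lpoly F) (a k.+1)) j 0) o.
  rewrite mul_diag_mx !mxE; apply: is_orderM (is_order_lpoly aj).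
  have X0 : 'X^(v k.+1 j) != 0 :> {poly F} by rewrite monic_neq0 ?monicXn.
  by have := is_orderV (is_order_lpoly X0); rewrite /deg size_polyXn opprK rmorphXn.
rewrite leNgt; apply/negP => lt.
have [/negP[]] := oE; rewrite low// /o.
by rewrite keyD mulNr.
Qed.

(** In the recurrence for the last column, the term [j = h k.+1] alone reaches degree [d k.+1]; all
    the others have smaller degree. *)
Lemma size_den_lcol k : in_len C k -> size (den (lcol C k)) = (d k).+1.
Proof.
elim/ltn_ind: k => -[|k] IH kC.
  by rewrite cf_d0 /den !mxE eqxx size_poly1.
have kC' := in_lenW (leqnSn _) kC.
rewrite lcolS denD den_sum (bigD1 (h k.+1))//= -addrA.
have dE : size (den (a k.+1 (h k.+1) 0 *: ccol C k.+1 (h k.+1))) = (d k.+1).+1.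
  have qn0 : den (lcol C k) != 0 by rewrite -size_poly_eq0 IH.
  rewrite denZ ccolS eqxx size_mul ?a_lead_neq0// IH//.
  have := a_lead_neq0 kC; rewrite -size_poly_gt0 cf_dS /cf_t /deg.
  by move: (size _) => s; lia.
rewrite size_polyDl ?dE// ltnS.
have lowdeg j : (size (den (ccol C k j)) <= d k)%N.
  case: (col_cases C k j) => [[-> _ _]|[i [ik -> _ _]]]; first by rewrite size_poly0.
  have iC : in_len C i.+1 by apply: in_lenW kC'.
  rewrite IH; [exact: leq_trans (cf_d_lt iC) (cf_d_mono ik)|lia|].
  exact: in_lenW (leqnSn _) iC.
apply: leq_trans (size_polyD _ _) _; rewrite geq_max; apply/andP; split; last first.
  by apply: leq_trans (lowdeg _) _; exact: cf_d_mono.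
apply: leq_trans (size_sum _ _ _) _; apply/bigmax_leqP => j jh.
rewrite denZ ccolS (negPf jh); have [->|aj] := eqVneq (a k.+1 j 0) 0.
  by rewrite mul0r size_poly0.
have := deg_a_le kC aj; case: (col_cases C k j) => [[-> _ _]|].
  by rewrite mulr0 size_poly0.
move=> [i [ik -> hi vk]] H.
have iC : in_len C i by apply: in_lenW kC; lia.
apply: leq_trans (size_polyMleq _ _) _; rewrite IH//; last by lia.
(* With the smaller kappa written through [d i] and the larger one through [d k.+1], their keys are
   those of the bound [H]. They cancel, leaving [d i] plus the degree of the entry below
   [d k.+1]. *)
have kap := kappa_lt ik kC.
rewrite kappaE' kappaE hi -vk in kap.
rewrite cf_vS (negPf jh) addn0 in H.
have {H kap} : ((d i)%:Z + (deg (a k.+1 j 0))%:Z) * M < (d k.+1)%:Z * M by lia.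
rewrite ltr_pM2r//; rewrite -size_poly_gt0 in aj.
by rewrite /deg; move: (size _) aj => s; lia.
Qed.

Lemma den_lcol_neq0 k : in_len C k -> den (lcol C k) != 0.
Proof. by move=> kC; rewrite -size_poly_eq0 size_den_lcol. Qed.

Lemma is_order_den k : in_len C k -> is_order (lpoly (den (lcol C k))) (- (d k)%:Z).
Proof.
by move=> kC; have := is_order_lpoly (den_lcol_neq0 kC); rewrite /deg size_den_lcol.
Qed.

Lemma err_lcol r k : in_len C k ->
  err r (lcol C k) = lpoly (den (lcol C k)) *: (r - convergent k).
Proof.
by move=> kC; rewrite errE ?den_lcol_neq0// /convergent conv_pE conv_qE.
Qed.

(** The vector [r] is left free: the property is proved first for [r] a later convergent and then
    transferred to the value of the fraction. *)
Definition approximated r k :=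
  forall i, (i < k)%N -> in_len C i.+1 -> vlead (r - convergent i) (kappa i.+1).

(** A column not yet replaced has a negated unit vector as error, led by [(j, 0)]. Otherwise it is a
    convergent column, and multiplying by its denominator takes [d i] off [kappa i.+1]. *)
Lemma vlead_err_ccol r k j : in_len C k -> approximated r k ->
  vlead (err r (ccol C k j)) (key j (v k j)).
Proof.
move=> kC rk; case: (col_cases C k j) => [[_ -> ->]|[i [ik -> hi vk]]].
  apply/vleadN/vlead_key; last by rewrite mxE !eqxx lcoef_poly coef1 oner_neq0.
  move=> l t; rewrite mxE andbT key_ltE; case: (eqVneq l j) => // ->.
  rewrite ltnn andbF orbF => t0; rewrite lcoef_poly coef1.
  by case: ifP => // _; case: eqP => //; lia.
have iC : in_len C i.+1 by apply: in_lenW kC.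
rewrite err_lcol; last exact: in_lenW iC.
have := vlead_scale (is_order_den (in_lenW (leqnSn _) iC)) (rk i ik iC).
by rewrite kappaE' hi vk mulNr addrK.
Qed.

Lemma convergents_approximated k : in_len C k -> approximated (convergent k) k.
Proof.
elim: k => // k IH kC; have kC' := in_lenW (leqnSn _) kC.
(* The error of [lcol k.+1] is taken against [convergent k]. In the recurrence the term [j = h k.+1]
   vanishes, the old column [h k.+1] provides the lead, and Condition 3 puts the other terms
   strictly beyond, since keys of distinct indices differ. *)
have step : vlead (convergent k.+1 - convergent k) (kappa k.+1).
  rewrite -opprB; apply: vleadN.
  rewrite {2}/convergent conv_pE conv_qE err_ratio ?den_lcol_neq0//.
  rewrite kappaE -[(d k.+1)%:Z]opprK; apply: vlead_scale.
    exact/is_orderV/is_order_den.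
  rewrite lcolS addrC errD; apply: vleadDr; first exact: vlead_err_ccol (IH kC').
  rewrite err_sum (bigD1 (h k.+1))//= errZ ccolS eqxx err_lcol// subrr !scaler0 add0r.
  apply: vlow_sum => j jh; rewrite errZ ccolS (negPf jh).
  have [->|aj] := eqVneq (a k.+1 j 0) 0.
    by rewrite rmorph0 scale0r; apply: vlow0.
  rewrite (vlow_scaleE _ _ (is_order_lpoly aj)).
  have [low _] := vlead_err_ccol j kC' (IH kC').
  apply: vlow_le low _; have := deg_a_le kC aj.
  rewrite cf_vS (negPf jh) addn0 le_eqVlt -mulNr -keyD => /predU1P[/key_inj[E _]|].
    by rewrite E eqxx in jh.
  by rewrite keyD; lia.
(* For earlier [i], the new difference starts beyond [kappa i.+1] and leaves that lead intact. *)
move=> i; rewrite ltnS leq_eqVlt => /predU1P[->//|ik] iC.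
have := IH kC' i ik iC; rewrite -(subrK (convergent k) (convergent k.+1)) -addrA addrC.
move=> /vleadDr; apply; apply: vlow_le step.1 _.
by have := kappa_lt ik kC; lia.
Qed.

End Convergents.

(** * Convergence to the value, and comparison with arbitrary fractions *)

Section Value.
Variables (F : fieldType) (n : nat) (C : precf F n).
Hypothesis cfC : is_cf C.
Local Notation M := (n.+1%:Z).
Local Notation d := (cf_d C).
Local Notation r := (cf_value C).

Lemma convergent_stable k k' j (t : int) : in_len C k' -> (k <= k')%N -> t < k%:Z ->
  convergent C k' j 0 t = convergent C k j 0 t.
Proof.
move=> kC; rewrite leq_eqVlt => /predU1P[->//|kk'] tk.
have kC' : in_len C k.+1 by apply: in_lenW kC.
have [low _] := convergents_approximated cfC kC kk' kC'.
have := low j t; rewrite !mxE lcoefD lcoefN => low'.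
apply/eqP; rewrite -subr_eq0 low'//; apply: lt_le_trans (kappa_ge cfC kC').
by rewrite /key; have := ltn_ord j; nia.
Qed.

Lemma convergent0 : convergent C 0 = 0.
Proof.
apply/colP => i; rewrite /convergent /ratio_vec !mxE eq_lrshift.
by rewrite rmorph0 mulr0.
Qed.

Lemma convergents_cvg : pcf_len C = None -> exists l, lcvg (convergent C) l.
Proof.
move=> Cinf; have allC k : in_len C k by rewrite /in_len Cinf.
(* The limit takes its coefficient [t] from convergent [|t|.+1], where it is already final; for
   negative [t] it agrees with convergent 0, which is zero. *)
have bounded j : exists N : int, forall t, t < N -> convergent C `|t|.+1 j 0 t = 0.
  exists 0 => t t0; rewrite (@convergent_stable 0)//.
  by rewrite convergent0 mxE.
exists (\col_j Laurent (bounded j)) => N; exists `|N|%N => k Nk.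
apply/vval_ge => j t tN.
rewrite mxE lcoefD [X in _ + lcoef X _]mxE lcoefN [X in _ - lcoef X _]mxE.
apply/eqP; rewrite subr_eq0; apply/eqP; case: (ltP t 0) => t0.
  by rewrite [RHS](@convergent_stable 0)//; exact: convergent_stable.
by apply: convergent_stable => //; lia.
Qed.

Lemma value_last k : in_len C k -> ~~ in_len C k.+1 -> r = convergent C k.
Proof.
rewrite /in_len /cf_value; case: (pcf_len C) => // w kw; rewrite -leqNgt => wk.
by rewrite (_ : w = k.+1)//; apply/eqP; rewrite eqn_leq wk kw.
Qed.

Lemma value_approximated k : approximated C r k.
Proof.
move=> i _ iC; case lenC: (pcf_len C) => [w|].
  have wC : in_len C w.-1.
    rewrite /in_len lenC ltn_predL; by move: iC; rewrite /in_len lenC; lia.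
  rewrite (value_last wC); last first.
    by rewrite /in_len lenC -leqNgt; exact: leqSpred.
  by apply: convergents_approximated => //; move: iC; rewrite /in_len lenC; lia.
have cvgr : lcvg (convergent C) r.
  by rewrite /cf_value lenC; apply: (xgetPex 0 (convergents_cvg lenC)).
(* This valuation bound is generous: as kappa is nonnegative, a key of at most kappa forces [t] to
   be at most kappa. *)
have [K rK] := cvgr (kappa C i.+1 + 1); set k' := maxn K i.+1.
have k'C : in_len C k' by rewrite /in_len lenC.
have ik' : (i < k')%N by rewrite leq_maxr.
have := convergents_approximated cfC k'C ik' iC.
rewrite -(subrK (convergent C k') r) -addrA addrC => /vleadDr; apply.
rewrite -opprB; apply: vlowN => j t; have /vval_ge low := rK k' (leq_maxl _ _).
have := kappa_ge cfC iC; rewrite /key => kap tk; apply: low.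
by nia.
Qed.

Lemma vlow_next k : in_len C k.+1 ->
  vlow (r - convergent C k.+1) (kappa C k.+1 + 1).
Proof.
move=> kC; have [kC'|/(value_last kC) ->] := boolP (in_len C k.+2); last first.
  by rewrite subrr; apply: vlow0.
have [low _] := value_approximated (ltnSn k.+1) kC'.
by apply: vlow_le low _; have := kappaS_lt cfC kC'; lia.
Qed.

(** The errors of the terms have leads in distinct classes modulo m, so the bound on the sum holds
    for each term. Comparing with [kappa i.+1], which is at most [kappa k.+1], turns it into a
    degree below [delta] for each term of the denominator. *)
Lemma size_den_columns k (c : 'I_n.+1 -> {poly F}) (delta : nat) : in_len C k.+1 ->
  vlow (err r (\sum_j c j *: ccol C k.+1 j)) (kappa C k.+1 + 1 - delta%:Z * M) ->
  (size (den (\sum_j c j *: ccol C k.+1 j)) <= delta)%N.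
Proof.
move=> kC; rewrite err_sum den_sum => low.
pose s j := key j (cf_v C k.+1 j) - (deg (c j))%:Z * M.
have slow j : c j != 0 -> kappa C k.+1 + 1 - delta%:Z * M <= s j.
  have E : \sum_i err r (c i *: ccol C k.+1 i) =
           \sum_(i | c i != 0) err r (c i *: ccol C k.+1 i).
    rewrite [RHS]big_mkcond; apply: eq_bigr => i _; case: eqVneq => // ->.
    by rewrite errZ rmorph0 scale0r.
  rewrite {}E in low; move: j; apply: vlow_sum_lead low => [j cj|i j _ _].
    rewrite errZ /s -mulNr; apply: vlead_scale (is_order_lpoly cj) _.
    by apply: vlead_err_ccol => //; exact: value_approximated.
  by rewrite /s -!mulNr -!keyD => /key_inj[].
apply: leq_trans (size_sum _ _ _) _; apply/bigmax_leqP => j _; rewrite denZ.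
have [->|cj] := eqVneq (c j) 0; first by rewrite mul0r size_poly0.
case: (col_cases C k.+1 j) => [[-> _ _]|]; first by rewrite mulr0 size_poly0.
move=> [i [ik -> hi vk]]; have iC : in_len C i.+1 by apply: in_lenW kC.
apply: leq_trans (size_polyMleq _ _) _; rewrite size_den_lcol//; last exact: in_lenW iC.
have kap := kappa_le cfC (ltnSE ik) kC.
have := slow j cj; rewrite /s vk; rewrite kappaE' hi in kap => H.
have {H kap} : ((d i)%:Z + (deg (c j))%:Z) * M < delta%:Z * M by lia.
rewrite ltr_pM2r//; rewrite -size_poly_gt0 in cj.
by rewrite /deg; move: (size _) cj => s'; lia.
Qed.

Lemma ratio_vec_err p (q : {poly F}) : q != 0 ->
  exists2 x, den x = q & r - ratio_vec p q = (lpoly q)^-1 *: err r x.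
Proof.
move=> q0; pose x : 'cV[{poly F}]_(n.+1 + 1) := col_mx p q%:M.
have dx : den x = q by rewrite /den col_mxKd mxE eqxx mulr1n.
by exists x => //; rewrite -{2}dx -err_ratio ?dx// /x col_mxKu.
Qed.

(** The numerator is arbitrary, so the bound serves for precisions and for competing approximants
    alike. At the last index the degree condition is void and the error of the convergent is
    zero. *)
Lemma convergent_best p (q : {poly F}) k :
  q != 0 -> in_len C k -> (in_len C k.+1 -> (deg q < d k.+1)%N) ->
  ivle (Iv (r - ratio_vec p q)) (Iv (r - convergent C k)).
Proof.
move=> q0 kC degq; have [kC'|/(value_last kC) ->] := boolP (in_len C k.+1); last first.
  by apply/ivleP => s _; rewrite subrr; apply: vlow0.
have {}degq := degq kC'.
have lead := value_approximated (ltnSn k) kC'.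
apply/ivleP => s low; rewrite (vleadE _ lead) leNgt; apply/negP => ks.
have [x dx E] := ratio_vec_err p q0; rewrite {}E in low.
rewrite (vlow_scaleE _ _ (is_orderV (is_order_lpoly q0))) opprK in low.
have {}low : vlow (err r x) (kappa C k.+1 + 1 - (deg q)%:Z * M).
  by apply: vlow_le low _; lia.
have [c [c0 xE]] := col_span C k.+1 x.
(* Without the last column, the bound on the error with [delta] equal to the degree of [q] would
   make that degree smaller than itself. *)
have [c00|c0n0] := eqVneq c0 0.
  rewrite c00 scale0r addr0 in xE; rewrite xE in low.
  have := size_den_columns kC' low; rewrite -xE dx /deg.
  by rewrite -size_poly_gt0 in q0; move: (size q) q0 => s'; lia.
have dx' : den x = den (\sum_j c j *: ccol C k.+1 j) + c0 * den (lcol C k.+1).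
  by rewrite xE denD denZ.
have sizeM : size (c0 * den (lcol C k.+1)) = (deg c0 + d k.+1).+1.
  rewrite size_mul ?den_lcol_neq0// size_den_lcol// /deg.
  by rewrite -size_poly_gt0 in c0n0; move: (size c0) c0n0 => s'; lia.
(* With the last column, its term has degree at least [d k.+1] and dominates the rest, so [q] would
   have too large a degree. *)
suff small : (size (den (\sum_j c j *: ccol C k.+1 j)%R) <= deg c0 + d k.+1)%N.
  have : size q = (deg c0 + d k.+1).+1.
    by rewrite -dx dx' addrC size_polyDl sizeM.
  by rewrite -size_poly_gt0 in q0; move: degq; rewrite /deg; move: (size q) q0 => s'; lia.
apply: size_den_columns => //.
have -> : err r (\sum_j c j *: ccol C k.+1 j) = err r x - lpoly c0 *: err r (lcol C k.+1).
  by rewrite xE errD errZ addrK.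
apply: vlowD; first by apply: vlow_le low _; rewrite lerD2l lerN2 ler_pM2r//; lia.
apply: vlowN; rewrite (vlow_scaleE _ _ (is_order_lpoly c0n0)) err_lcol//.
rewrite (vlow_scaleE _ _ (is_order_den cfC kC')).
by apply: vlow_le (vlow_next kC') _; rewrite PoszD; lia.
Qed.

(** For fixed [q], a polynomial numerator cannot affect the coefficients of negative powers of z,
    and the polynomial part removes all the others. *)
Lemma precision_ge p (q : {poly F}) : q != 0 ->
  ivle (Iv (r - ratio_vec p q)) (precision r q).
Proof.
move=> q0; apply/ivleP => s.
have lq0 : lpoly q != 0 by rewrite -(rmorph0 (@lpoly F)) (inj_eq (@lpoly_inj F)).
have E p' : r - ratio_vec p' q =
    (lpoly q)^-1 *: (lpoly q *: r - map_mx (@lpoly F) p').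
  by rewrite scalerBr scalerA mulVf// scale1r.
rewrite !E !(vlow_scaleE _ _ (is_orderV (is_order_lpoly q0))).
move: (s - _) => {}s low j t jt; have := low j t jt; rewrite !mxE !lcoefD !lcoefN.
case: (leP t 0) => t0; last by rewrite !lcoef_poly_gt0.
move=> _; rewrite [X in - X]lcoef_poly t0 coef_lfloor.
by rewrite (_ : - `|t|%N%:Z = t) ?mxE ?subrr//; lia.
Qed.

End Value.

Theorem theorem6p4 (F : fieldType) (n : nat) (C : precf F n) :
  is_cf C ->
  let r := cf_value C in
  (forall (q : {poly F}) (k : nat),
     q != 0 -> in_len C k ->
     (cf_dbar C k <= ((deg q)%:Z)%:E < cf_dbar C k.+1)%E ->
     ivle (precision r q) (Iv (r - ratio_vec (conv_p C k) (conv_q C k)))) /\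
  (forall k : nat, in_len C k ->
     best_approximant r (conv_p C k) (conv_q C k)) /\
  (forall q : {poly F}, best_denominator r q ->
     exists2 k : nat, in_len C k & deg q = cf_d C k).
Proof.
move=> cfC r.
have q_neq0 k : in_len C k -> conv_q C k != 0.
  by move=> kC; rewrite conv_qE den_lcol_neq0.
have deg_q k : in_len C k -> deg (conv_q C k) = cf_d C k.
  by move=> kC; rewrite conv_qE /deg size_den_lcol.
split; [|split].
- move=> q k q0 kC /andP[_ lt]; apply: convergent_best => // kC'.
  by move: lt; rewrite /cf_dbar kC' lte_fin; lia.
- move=> k kC; split=> [|q q0|q q0 degq]; first exact: q_neq0.
    rewrite deg_q//; case: k kC => [|k] kC; first by rewrite cf_d0.
    (* Strictness comes from the previous convergent: a smaller degree does no better than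
       [convergent C k], whose error leads at [kappa C k.+1], while the next error starts beyond
       it. *)
    move=> degq; apply/ivltP; exists (kappa C k.+1 + 1); first exact: vlow_next.
    move=> low; have kC' := in_lenW (leqnSn _) kC.
    have /ivleP/(_ _ low) := convergent_best cfC
      (map_mx (@lfloor F) (lpoly q *: r)) q0 kC' (fun=> degq).
    by have [] := value_approximated cfC (ltnSn k) kC.
  apply: convergent_best => // kC'; rewrite degq deg_q//; exact: cf_d_lt.
- move=> q [p [q0 best _]].
  (* The index sought is the last one with [cf_d C k] at most the degree of [q]. If the inequality
     were strict, [q] would have to beat the denominator of convergent [k] strictly, although
     [convergent_best] says that it does no better. *)
  have ex0 : exists k, in_len C k && (cf_d C k <= deg q)%N.
    by exists 0%N; rewrite in_len0 cf_d0.
  have bound k : in_len C k && (cf_d C k <= deg q)%N -> (k <= deg q)%N.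
    by move=> /andP[kC]; apply: leq_trans; exact: cf_d_ge.
  case: (ex_maxnP ex0 bound) => k /andP[kC dk] kmax; exists k => //.
  apply/eqP; move: dk; rewrite eq_sym leq_eqVlt => /orP[//|dk].
  have dq : (deg (conv_q C k) < deg q)%N by rewrite deg_q.
  have /ivltP[s low []] := best _ (q_neq0 k kC) dq.
  have /ivleP := precision_ge C (conv_p C k) (q_neq0 k kC); apply.
  suff /ivleP : ivle (Iv (r - ratio_vec p q)) (Iv (r - convergent C k)) by apply.
  apply: convergent_best => // kC'; rewrite ltnNge; apply/negP => dk'.
  by have := kmax k.+1; rewrite kC' dk' ltnn => /(_ isT).
Qed.
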